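(* Assume $\sigma$ is surjective and every $(\sigma,\delta)$-conjugacy class of $\mathbb{F}$ is algebraic. Let $\mathbf a=(a_1,\dots,a_r)\in\mathbb{F}^r$ with $r\ge2$. The following are equivalent: (1) $\mathbf a$ is a $(\sigma,\delta)$-multiplicity sequence; (2) whenever $b_1,\dots,b_r\in\mathbb{F}$ satisfy $P_{\mathbf a}=(x-b_r)\cdots(x-b_1)$, we have $b_i=a_i$ for all $i$; (3) $(a_i,a_{i+1})$ is a $(\sigma,\delta)$-multiplicity sequence for $i=1,\dots,r-1$; (4) for each $i=1,\dots,r-1$ there exists $\beta_i\in\mathbb{F}^*$ with $a_{i+1}=a_i^{\beta_i}$ and $\beta_i\notin\{\sigma(\beta)a_i+\delta(\beta)-a_i\beta:\beta\in\mathbb{F}\}$ (equivalently $\beta_i\notin\{(a_i^\beta-a_i)\beta:\beta\in\mathbb{F}^*\}\cup\{0\}$); (5) $x-a_r$ is the only monic skew polynomial of degree $1$ that divides $P_{\mathbf a}$ on the left.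
   Context: Let $\mathbb{F}$ be a division ring, $\sigma$ a ring endomorphism and $\delta$ a $\sigma$-derivation; $\mathbb{F}[x;\sigma,\delta]$ is the skew polynomial ring with $xa=\sigma(a)x+\delta(a)$. For $\mathbf a=(a_1,\dots,a_r)$, $P_{\mathbf a}=(x-a_r)\cdots(x-a_1)$; $\mathbf a$ is a $(\sigma,\delta)$-multiplicity sequence if $a_1$ is the only $b\in\mathbb{F}$ such that $x-b$ divides $P_{\mathbf a}$ on the right. Conjugation: $a^\beta=\sigma(\beta)a\beta^{-1}+\delta(\beta)\beta^{-1}$; the conjugacy class of $a$ is $C^{\sigma,\delta}(a)=\{a^\beta:\beta\in\mathbb{F}^*\}$. A set $S\subseteq\mathbb{F}$ is algebraic if some non-zero skew polynomial is right-divisible by $x-b$ for every $b\in S$. *)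

(* Defs.v *)
From HB Require Import structures.
From mathcomp Require Import all_boot all_order all_algebra.
Set Implicit Arguments. Unset Strict Implicit. Unset Printing Implicit Defensive.
Import GRing.Theory.
Local Open Scope ring_scope.

(* Skew polynomial ring F[x; sigma, delta], represented on the additive group
   {poly F} (coefficient sequence sum_i p_i x^i, coefficients on the left),
   with the skew multiplication defined below (x a = sigma(a) x + delta(a)). *)
Section Skew.
Variables (F : unitRingType) (sigma delta : F -> F).

Definition is_sderivation : Prop :=
  (forall a b, delta (a + b) = delta a + delta b) /\
  (forall a b, delta (a * b) = sigma a * delta b + delta a * b).

(* left multiplication by x: x * (sum q_j x^j) = sum (sigma q_j x^(j+1) + delta q_j x^j) *)
Definition skew_mulX (q : {poly F}) : {poly F} :=
  map_poly sigma q * 'X + map_poly delta q.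

Definition skew_mul (p q : {poly F}) : {poly F} :=
  \sum_(i < size p) p`_i *: iter i skew_mulX q.

Definition rdvd (f p : {poly F}) : Prop := exists g, p = skew_mul g f.
Definition ldvd (f p : {poly F}) : Prop := exists g, p = skew_mul f g.

(* P_a = (x - a_r) ... (x - a_1) for a = [:: a_1; ...; a_r] *)
Definition Pseq (s : seq F) : {poly F} :=
  foldr (fun a p => skew_mul p ('X - a%:P)) 1 s.

Definition mult_seq (s : seq F) : Prop :=
  rdvd ('X - (nth 0 s 0)%:P) (Pseq s) /\
  forall b, rdvd ('X - b%:P) (Pseq s) -> b = nth 0 s 0.

Definition sconj (a beta : F) : F :=
  sigma beta * a * beta^-1 + delta beta * beta^-1.

Definition conj_class (a : F) : F -> Prop :=
  fun c => exists beta, beta != 0 /\ c = sconj a beta.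

Definition algebraic_set (S : F -> Prop) : Prop :=
  exists f : {poly F}, f != 0 /\ forall b, S b -> rdvd ('X - b%:P) f.

End Skew.

(* Main.v *)
(* Writing R for the skew polynomial ring, a multiplicity sequence is one for
   which R/RP has a unique submodule with one-dimensional quotient.  The bound
   f of l = x - a_1 generates the largest two-sided ideal inside Rl; it is
   non-zero because the conjugacy class of a_1 is algebraic, and fR = Rf because
   sigma is surjective.  When l is the only linear right divisor of P = Ql, one
   gets Rl = Rf + RP, so Rl/RP is the image of multiplication by f on R/RP.
   Pulling a submodule back along this multiplication shows that Q again has
   only one linear right divisor.  Hence uniqueness passes to tails, and so to
   consecutive pairs.  All of this uses only Euclidean division on both sides
   and is left-right symmetric, so the opposite ring gives the same for linear
   left divisors.  For a pair the two uniqueness conditions coincide, and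
   pairwise uniqueness propagates back to the whole product. *)
Require Import Defs.
From HB Require Import structures.
From mathcomp Require Import all_boot all_order all_algebra.
From mathcomp Require Import zify.
From Stdlib Require Import Classical_Prop.
Set Implicit Arguments. Unset Strict Implicit. Unset Printing Implicit Defensive.
Import GRing.Theory.
Local Open Scope ring_scope.

(* The size is the degree plus one: 0 only at 0, and 1 exactly on units. *)
Definition euclidean_size (R : nzRingType) (sz : R -> nat) : Prop :=
  [/\ forall u, (sz u == 0%N) = (u == 0),
      forall u v, u != 0 -> v != 0 -> sz (u * v) = (sz u + sz v).-1,
      forall u g, g != 0 -> exists q s, u = q * g + s /\ (sz s < sz g)%N
    & forall u g, g != 0 -> exists q s, u = g * q + s /\ (sz s < sz g)%N].

Definition right_div (R : nzRingType) (m p : R) : Prop := exists q, p = q * m.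

(* For l = x - a in a skew polynomial ring, the condition on f says that f
   vanishes on the whole conjugacy class of a. *)
Definition bounded_lin (R : nzRingType) (sz : R -> nat) : Prop :=
  forall l, sz l = 2%N -> exists2 f, f != 0 & forall r, right_div l (f * r).

(* Uniqueness is up to left unit factors, which do not change the left ideal. *)
Definition uniq_lin_div (R : nzRingType) (sz : R -> nat) (l p : R) : Prop :=
  forall m, sz m = 2%N -> right_div m p -> right_div l m.

(** The opposite ring only exchanges the two divisions, so what is proved for right divisors can be
    reused for left divisors. *)
Lemma euclidean_size_conv (R : nzRingType) (sz : R -> nat) :
  euclidean_size sz -> @euclidean_size R^c sz.
Proof.
case=> sz0 szM El Er; split=> //.
by move=> u v u0 v0; rewrite [LHS]szM // addnC.
Qed.

(** * Euclidean domains with bounded linear elements *)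

Section RightDiv.
Variable R : nzRingType.
Implicit Types l m p q u v : R.

Lemma right_div_refl m : right_div m m.
Proof. by exists 1; rewrite mul1r. Qed.

Lemma right_divMl m p q : right_div m p -> right_div m (q * p).
Proof. by case=> k ->; exists (q * k); rewrite mulrA. Qed.

Lemma right_divD m p q : right_div m p -> right_div m q -> right_div m (p + q).
Proof. by case=> k -> [k' ->]; exists (k + k'); rewrite mulrDl. Qed.

Lemma right_divN m p : right_div m p -> right_div m (- p).
Proof. by case=> k ->; exists (- k); rewrite mulNr. Qed.

Lemma right_divB m p q : right_div m p -> right_div m q -> right_div m (p - q).
Proof. by move=> mp mq; apply: right_divD => //; apply: right_divN. Qed.

Lemma right_div_trans m p q : right_div m p -> right_div p q -> right_div m q.
Proof. by move=> mp [k ->]; apply: right_divMl. Qed.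

End RightDiv.

Section Euclidean.
Variables (R : nzRingType) (sz : R -> nat).
Hypothesis szR : euclidean_size sz.
Implicit Types l m p q u v : R.

Let sz0 u : (sz u == 0%N) = (u == 0). Proof. by case: szR => h _ _ _; apply: h. Qed.
Let szM u v : u != 0 -> v != 0 -> sz (u * v) = (sz u + sz v).-1.
Proof. by case: szR => _ h _ _; apply: h. Qed.

Lemma sz_neq0 u n : sz u = n.+1 -> u != 0.
Proof. by move=> szu; rewrite -sz0 szu. Qed.

Lemma sz_gt0 u : u != 0 -> (0 < sz u)%N.
Proof. by rewrite -sz0 lt0n. Qed.

Lemma szM_neq0 u v : u != 0 -> v != 0 -> u * v != 0.
Proof.
move=> u0 v0; have := sz_gt0 u0; have := sz_gt0 v0.
by rewrite -sz0 szM //; lia.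
Qed.

Lemma szM_eq0 u v : u * v = 0 -> u = 0 \/ v = 0.
Proof.
case: (eqVneq u 0) => [|u0]; first by left.
case: (eqVneq v 0) => [|v0]; first by right.
by move/eqP; rewrite (negbTE (szM_neq0 u0 v0)).
Qed.

Lemma szMI u v w : u != 0 -> u * v = u * w -> v = w.
Proof.
move=> u0 /eqP; rewrite -subr_eq0 -mulrBr => /eqP /szM_eq0[e|/eqP].
  by rewrite e eqxx in u0.
by rewrite subr_eq0 => /eqP.
Qed.

Lemma szIM u v w : u != 0 -> v * u = w * u -> v = w.
Proof.
move=> u0 /eqP; rewrite -subr_eq0 -mulrBl => /eqP /szM_eq0[/eqP|e].
  by rewrite subr_eq0 => /eqP.
by rewrite e eqxx in u0.
Qed.

(** Dividing 1 by [u] leaves remainder 0, which gives a left inverse; cancelling [u] makes it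
    two-sided. *)
Lemma sz1_unit u : sz u = 1%N -> exists v, [/\ sz v = 1%N, u * v = 1 & v * u = 1].
Proof.
move=> szu; have u0 := sz_neq0 szu; case: szR => _ _ El _.
have [v [s [e]]] := El 1 u u0; rewrite szu ltnS leqn0 sz0 => /eqP s0.
move: e; rewrite s0 addr0 => e; have v0 : v != 0.
  by apply: contra_eq_neq e => ->; rewrite mul0r oner_neq0.
have uv : u * v = 1 by apply: (szIM u0); rewrite -mulrA -e mulr1 mul1r.
exists v; split=> //.
have := szM u0 v0; rewrite uv szu; have : sz (1 * 1) = (sz 1 + sz 1).-1.
  by apply: szM; apply: oner_neq0.
rewrite mulr1; have := sz_gt0 v0; have := sz_gt0 (oner_neq0 R); lia.
Qed.

Lemma right_div_sz l m : m != 0 -> right_div l m -> (sz l <= sz m)%N.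
Proof.
move=> m0 [q e]; have q0 : q != 0 by apply: contra_neq m0 => q0; rewrite e q0 mul0r.
have l0 : l != 0 by apply: contra_neq m0 => l0; rewrite e l0 mulr0.
rewrite e szM //; have := sz_gt0 q0; lia.
Qed.

Lemma right_div_unitl l u p : sz u = 1%N -> right_div l (u * p) -> right_div l p.
Proof.
move=> /sz1_unit[v [_ _ vu]] /(right_divMl v); by rewrite mulrA vu mul1r.
Qed.

Lemma right_div_same_sz l m : sz m = sz l -> m != 0 -> right_div l m ->
  exists e, sz e = 1%N /\ m = e * l.
Proof.
move=> szml m0 [q e]; exists q; split=> //.
have q0 : q != 0 by apply: contra_neq m0 => q0; rewrite e q0 mul0r.
have l0 : l != 0 by rewrite -sz0 -szml sz0.
have := sz_gt0 l0; have := sz_gt0 q0; have := szM q0 l0; rewrite -e szml; lia.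
Qed.

Lemma right_div_antisym l m :
  sz m = sz l -> m != 0 -> right_div l m -> right_div m l.
Proof.
move=> szml m0 /(right_div_same_sz szml m0)[e [sze mE]].
by have [v [_ _ ve]] := sz1_unit sze; exists v; rewrite mE mulrA ve mul1r.
Qed.

(** Descent on the size; [P] is an arbitrary predicate, so each step decides by excluded middle
    whether a smaller non-zero element exists. *)
Lemma ex_min_sz (P : R -> Prop) : (exists2 f, f != 0 & P f) ->
  exists f, [/\ f != 0, P f & forall g, P g -> (sz g < sz f)%N -> g = 0].
Proof.
case=> f; have [n] := ubnP (sz f); elim: n f => // n IH f szf f0 Pf.
have [[g [Pg szg g0]]|noG] :
    (exists g, [/\ P g, (sz g < sz f)%N & g != 0]) \/
    ~ (exists g, [/\ P g, (sz g < sz f)%N & g != 0]) by apply: classic.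
  by apply: (IH g) => //; lia.
exists f; split=> // g Pg szg; case: (eqVneq g 0) => // g0.
by case: noG; exists g.
Qed.

(** [P] is a left ideal: the remainder on division by [f] stays in it and is smaller than [f], so it
    vanishes. *)
Lemma min_sz_right_div (P : R -> Prop) f :
    (forall u v, P u -> P v -> P (u - v)) -> (forall q u, P u -> P (q * u)) ->
    f != 0 -> P f -> (forall g, P g -> (sz g < sz f)%N -> g = 0) ->
  forall g, P g -> right_div f g.
Proof.
move=> PB PM f0 Pf minf g Pg; case: szR => _ _ El _.
have [q [s [e szs]]] := El g f f0; exists q.
have es : s = g - q * f by rewrite e addrC addKr.
by rewrite e (minf s) ?addr0 // es; apply: PB => //; apply: PM.
Qed.

(* Throughout, f generates the largest two-sided ideal contained in Rl. *)
Section Bound.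
Variables l f : R.
Hypotheses (szl : sz l = 2%N) (f0 : f != 0) (fl : forall r, right_div l (f * r)).
Hypothesis minf :
  forall g, (forall r, right_div l (g * r)) -> (sz g < sz f)%N -> g = 0.

Let l0 : l != 0. Proof. exact: sz_neq0 szl. Qed.

(** The elements [g] with gR inside Rl form a left ideal, the annihilator of R/Rl. *)
Lemma bound_gen g : (forall r, right_div l (g * r)) -> right_div f g.
Proof.
apply: (min_sz_right_div (P := fun g => forall r, right_div l (g * r))) => //.
- by move=> u v Pu Pv r; rewrite mulrBl; apply: right_divB.
- by move=> q u Pu r; rewrite -mulrA; apply: right_divMl.
Qed.

Lemma bound_normr r : exists r', f * r = r' * f.
Proof. by apply: bound_gen => r'; rewrite -mulrA. Qed.

(** Here the division on the other side is used: the remainder of [r * f] still sends R into Rl and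
    is smaller than [f], so it is 0. *)
Lemma bound_norml r : exists r', r * f = f * r'.
Proof.
case: szR => _ _ _ Er; have [q [s [e szs]]] := Er (r * f) f f0; exists q.
have es : s = r * f - f * q by rewrite e addrC addKr.
rewrite e (minf _ szs) ?addr0 // => r'; rewrite es mulrBl.
by apply: right_divB; rewrite -mulrA //; apply: right_divMl.
Qed.

Lemma bound_normr_unit u : sz u = 1%N -> exists2 u', sz u' = 1%N & f * u = u' * f.
Proof.
move=> szu; have [u' e] := bound_normr u; exists u' => //.
have u0 := sz_neq0 szu; have := szM_neq0 f0 u0; have := szM f0 u0.
rewrite e => szE uf0; have u'0 : u' != 0.
  by apply: contra_neq uf0 => ->; rewrite mul0r.
have := sz_gt0 f0; have := sz_gt0 u'0; move: szE; rewrite szM // szu; lia.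
Qed.

(* Normality gives h f = f h' = h g h', and h cancels. *)
Lemma bound_swap h g : f = h * g -> exists h', f = g * h'.
Proof.
move=> e; have h0 : h != 0 by apply: contra_neq f0 => h0; rewrite e h0 mul0r.
have [h' e'] := bound_norml h; exists h'; apply: (szMI h0).
by rewrite e' mulrA -e.
Qed.

(** Modulo [l] every element reduces to 0 or to a unit. If [g] sent all units into Rl, it would send
    all of R there, against the minimality of [f]. *)
Lemma nonbound_value g : g != 0 -> (sz g < sz f)%N ->
  exists c, sz c = 1%N /\ ~ right_div l (g * c).
Proof.
move=> g0 szg; apply: NNPP => noc; move/eqP: g0; apply.
apply: minf => // r; case: szR => _ _ El _.
have [q [c [-> szc]]] := El r l l0; rewrite mulrDr.
apply: right_divD; first by exists (g * q); rewrite mulrA.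
case: (eqVneq c 0) => [->|c0]; first by exists 0; rewrite mulr0 mul0r.
apply: NNPP => nl; apply: noc; exists c; split=> //.
by have := sz_gt0 c0; lia.
Qed.

(** In [f = m * h'] the factor [h'] is smaller than [f], so [h' * c] is outside Rl for some unit
    [c]. Its remainder [s] modulo [l] is a unit, and [m * s] is [f * c] modulo Rl, hence 0. *)
Lemma bound_div_similar m : sz m = 2%N -> right_div m f ->
  exists c, sz c = 1%N /\ right_div l (m * c).
Proof.
move=> szm [h fE]; have [h' fE'] := bound_swap fE; have m0 := sz_neq0 szm.
have h'0 : h' != 0 by apply: contra_neq f0 => h0; rewrite fE' h0 mulr0.
have [|c [szc nlc]] := nonbound_value h'0.
  by rewrite fE' szM // szm; have := sz_gt0 h'0; lia.
case: szR => _ _ El _; have [q [s [e szs]]] := El (h' * c) l l0.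
exists s; split.
  have s0 : s != 0.
    by apply/eqP => s0; apply: nlc; exists q; rewrite e s0 addr0.
  by have := sz_gt0 s0; lia.
have -> : m * s = f * c - m * q * l.
  by rewrite fE' -!mulrA e mulrDr addrC addKr.
by apply: right_divB => //; exists (m * q).
Qed.

Variable Q : R.
Hypotheses (Q0 : Q != 0) (uniq_l : uniq_lin_div sz l (Q * l)).

(* The gcd g of f and Q l is l up to a unit: if g had larger size, write
   f = g h'; then l h' is too small to be a multiple of f, so some constant s
   has g s in Rl but l s not in Rl, which makes l s^-1 a second linear divisor. *)
Lemma bound_bezout : exists a b, l = a * f + b * (Q * l).
Proof.
have [|g [g0 [a [b gE]] ming]] :=
  @ex_min_sz (fun g => exists a b, g = a * f + b * (Q * l)).
  by exists f => //; exists 1, 0; rewrite mul0r addr0 mul1r.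
have gen : forall h, (exists a b, h = a * f + b * (Q * l)) -> right_div g h.
  apply: min_sz_right_div => //; last by exists a, b.
  - move=> _ _ [a1 [b1 ->]] [a2 [b2 ->]]; exists (a1 - a2), (b1 - b2).
    by rewrite !mulrBl opprD addrACA.
  - move=> q _ [a1 [b1 ->]]; exists (q * a1), (q * b1).
    by rewrite mulrDr !mulrA.
have gf : right_div g f by apply: gen; exists 1, 0; rewrite mul0r addr0 mul1r.
have gP : right_div g (Q * l) by apply: gen; exists 0, 1; rewrite mul0r add0r mul1r.
have lg : right_div l g.
  rewrite gE; apply: right_divD; last by exists (b * Q); rewrite mulrA.
  by apply: right_divMl; rewrite -[f]mulr1.
suff gl : right_div g l.
  by case: gl => q lE; exists (q * a), (q * b); rewrite {1}lE {1}gE mulrDr !mulrA.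
have szlg := right_div_sz g0 lg.
have [szg|szg] := leqP (sz g) 2.
  by apply: right_div_antisym => //; lia.
have [h fE] := gf; have [h' fE'] := bound_swap fE.
have h'0 : h' != 0 by apply: contra_neq f0 => h0; rewrite fE' h0 mulr0.
have [||c [szc nlc]] := @nonbound_value (l * h'); first exact: szM_neq0.
  by rewrite fE' !szM // szl; have := sz_gt0 h'0; lia.
case: szR => _ _ El _; have [q [s [e szs]]] := El (h' * c) l l0.
have nls : ~ right_div l (l * s).
  move=> ls; apply: nlc; rewrite -mulrA e mulrDr; apply: right_divD => //.
  by exists (l * q); rewrite mulrA.
have s0 : s != 0.
  by apply/eqP => s0; apply: nls; rewrite s0 mulr0; exists 0; rewrite mul0r.
have szs1 : sz s = 1%N by have := sz_gt0 s0; lia.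
have [s' [szs' ss' s's]] := sz1_unit szs1.
have gs : right_div l (g * s).
  have -> : g * s = f * c - g * q * l by rewrite fE' -!mulrA e mulrDr addrC addKr.
  by apply: right_divB => //; exists (g * q).
have szls : sz (l * s') = 2%N by rewrite szM ?(sz_neq0 szs') // szl szs'.
have lsg : right_div (l * s') g.
  by case: gs => k ek; exists k; rewrite mulrA -ek -mulrA ss' mulr1.
have := uniq_l szls (right_div_trans lsg gP) => lls.
case: nls; have [|k ek] := right_div_antisym _ (sz_neq0 szls) lls.
  by rewrite szls szl.
by exists k; rewrite {1}ek -!mulrA s's mulr1.
Qed.

(** If [m * l] divided [f], it would divide both terms of the Bezout expression for [l], hence [l]
    itself, which is smaller. *)
Lemma bound_notin m : sz m = 2%N -> right_div m Q -> ~ right_div (m * l) f.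
Proof.
move=> szm [q qE] ff; have [a [b lE]] := bound_bezout; have m0 := sz_neq0 szm.
have : right_div (m * l) l.
  rewrite {2}lE; apply: right_divD; first exact: right_divMl.
  by apply: right_divMl; exists q; rewrite qE mulrA.
move/(right_div_sz l0); rewrite szM // szm szl; lia.
Qed.

(* Write f = f1 l and f1 = q m + c.  If c <> 0, then v = m c^-1 satisfies
   v f in Rml; as v f = f u with u of size 2, u divides Q l, so u is l up to a
   unit and f l lies in Rml. *)
Lemma bound_tail m : sz m = 2%N -> right_div m Q -> right_div m f.
Proof.
move=> szm mQ; have m0 := sz_neq0 szm; have nf := bound_notin szm mQ.
have [f1 fE] := fl 1; rewrite mulr1 in fE.
case: szR => _ _ El _; have [q [c [f1E szc]]] := El f1 m m0.
have c0 : c != 0.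
  apply/eqP => c0; apply: nf; exists q.
  by rewrite fE f1E c0 addr0 mulrA.
have szc1 : sz c = 1%N by have := sz_gt0 c0; lia.
have [c' [szc' cc' c'c]] := sz1_unit szc1.
have vf : right_div (m * l) (m * c' * f).
  exists (m * c' * q + 1); rewrite fE f1E [LHS]mulrA [RHS]mulrA; congr (_ * l).
  by rewrite mulrDr mulrDl mul1r -!mulrA c'c mulr1.
have szv : sz (m * c') = 2%N by rewrite szM ?(sz_neq0 szc') // szm szc'.
have v0 := sz_neq0 szv.
have [u uE] := bound_norml (m * c').
have u0 : u != 0.
  by apply: contra_neq (szM_neq0 v0 f0) => u0; rewrite uE u0 mulr0.
have szu : sz u = 2%N.
  have := szM v0 f0; rewrite uE szM // szv.
  by have := sz_gt0 f0; have := sz_gt0 u0; lia.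
rewrite uE in vf.
(* To see that [u] divides [Q * l]: both [f * u] and [f * (Q * l)] lie in Rml, hence so does
   [f * s]; a unit [s] would put [f] itself there. *)
have [q' [s [PE szs]]] := El (Q * l) u u0.
have fs : right_div (m * l) (f * s).
  have -> : s = Q * l - q' * u by rewrite PE addrC addKr.
  rewrite mulrBr; apply: right_divB.
    by apply: right_divMl; case: mQ => k ->; exists k; rewrite mulrA.
  by have [q2 e2] := bound_normr q'; rewrite mulrA e2 -mulrA; apply: right_divMl.
have s0 : s = 0.
  apply/eqP/negPn/negP => s0; apply: nf.
  have szs1 : sz s = 1%N by have := sz_gt0 s0; lia.
  have [s' szs' e'] := bound_normr_unit szs1.
  by apply: (right_div_unitl szs'); rewrite -e'.
have [||e [sze ue]] := @right_div_same_sz l u _ u0; first by rewrite szu.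
  by apply: uniq_l => //; exists q'; rewrite PE s0 addr0.
have [e' sze' ee] := bound_normr_unit sze.
have := vf; rewrite ue mulrA ee -mulrA => /(right_div_unitl sze')[k ek].
by exists k; apply: (szIM l0); rewrite ek mulrA.
Qed.

(** Multiplying the Bezout identity by [m] gives [m * l = f * u + m * b * (Q * l)], so [f * u] lies
    in Rml, and this forces [l] to divide [u]. Then [f * u] is a left multiple of [f * l], hence of
    [m' * l] because [m'] divides [f]. So [m' * l] divides [m * l], and [l] cancels. *)
Lemma bound_uniq_tail m m' : sz m = 2%N -> sz m' = 2%N ->
  right_div m Q -> right_div m' Q -> right_div m' m.
Proof.
move=> szm szm' mQ m'Q; have [a [b lE]] := bound_bezout.
have divP k : right_div k Q -> right_div (k * l) (Q * l).
  by case=> q ->; exists q; rewrite mulrA.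
have divf k : right_div k f -> right_div (k * l) (f * l).
  by case=> q {1}->; exists q; rewrite mulrA.
have [u uE] := bound_norml (m * a).
have mlE : m * l = f * u + m * b * (Q * l) by rewrite {1}lE mulrDr !mulrA uE.
have fu : right_div (m * l) (f * u).
  have -> : f * u = m * l - m * b * (Q * l) by rewrite mlE addrK.
  apply: right_divB; first exact: right_div_refl.
  by apply: right_divMl; apply: divP.
case: szR => _ _ El _; have [w [s [e szs]]] := El u l l0.
have [w' wE] := bound_normr w.
have s0 : s = 0.
  apply/eqP/negPn/negP => s0; apply: (bound_notin szm mQ).
  have szs1 : sz s = 1%N by have := sz_gt0 s0; lia.
  have [s' szs' e'] := bound_normr_unit szs1.
  apply: (right_div_unitl szs'); rewrite -e'.
  have -> : f * s = f * u - w' * (f * l).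
    by rewrite e mulrDr !mulrA wE addrC addKr.
  apply: right_divB => //; apply: right_divMl; apply: divf.
  exact: bound_tail.
have : right_div (m' * l) (m * l).
  rewrite mlE e s0 addr0; apply: right_divD.
    by rewrite mulrA wE -mulrA; apply: right_divMl; apply: divf; apply: bound_tail.
  by apply: right_divMl; apply: divP.
by case=> k ek; exists k; apply: (szIM l0); rewrite ek mulrA.
Qed.

End Bound.

(** * Inheritance and gluing of unique linear divisors *)

Hypothesis bddR : bounded_lin sz.

Lemma ex_bound l : sz l = 2%N ->
  exists f, [/\ f != 0, forall r, right_div l (f * r)
    & forall g, (forall r, right_div l (g * r)) -> (sz g < sz f)%N -> g = 0].
Proof. by move=> szl; apply: ex_min_sz; apply: bddR. Qed.

Lemma uniq_lin_div_tail l Q m m' : sz l = 2%N -> Q != 0 ->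
    uniq_lin_div sz l (Q * l) -> sz m = 2%N -> sz m' = 2%N ->
  right_div m Q -> right_div m' Q -> right_div m' m.
Proof.
move=> szl Q0 uQ szm szm'; have [f [f0 fl minf]] := ex_bound szl.
exact: (bound_uniq_tail szl f0 fl minf Q0 uQ szm szm').
Qed.

(** With [m] itself as the tail, [m] divides the bound of [l]. The unit [c] later becomes the
    conjugating element of a pair. *)
Lemma uniq_lin_div_similar l m : sz l = 2%N -> sz m = 2%N ->
    uniq_lin_div sz l (m * l) -> exists c, sz c = 1%N /\ right_div l (m * c).
Proof.
move=> szl szm um; have [f [f0 fl minf]] := ex_bound szl.
have m0 := sz_neq0 szm; apply: (bound_div_similar szl f0 fl minf szm).
apply: (bound_tail szl f0 fl minf m0 um szm); exact: right_div_refl.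
Qed.

(** The same bound serves on the other side: [f = l * h'] and [r * f = f * r'] give
    [r * f = l * h' * r']. *)
Lemma bounded_lin_conv : @bounded_lin R^c sz.
Proof.
move=> l szl; have [f [f0 fl minf]] := ex_bound szl.
have [h fE] := fl 1; rewrite mulr1 in fE.
have [h' fE'] := bound_swap f0 fl minf fE.
exists f => // r; have [r' rE] := bound_norml f0 fl minf r.
by exists (h' * r' : R); rewrite [LHS]rE fE' -mulrA.
Qed.

End Euclidean.

(** Divide [l = q * k + c]. If [c] is a unit, [Q * m * c] lies in Rk, so k c^-1 is a linear divisor
    of [Q * m] and agrees with [m] up to a unit; thus [m * c] lies in Rk. In either case [k] divides
    [m * l], where uniqueness applies. *)
Lemma uniq_lin_div_glue (R : nzRingType) (sz : R -> nat) (szR : euclidean_size sz)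
    (l m Q : R) : sz l = 2%N -> sz m = 2%N ->
  uniq_lin_div sz m (Q * m) -> uniq_lin_div sz l (m * l) ->
  uniq_lin_div sz l (Q * m * l).
Proof.
move=> szl szm um ul k szk kP; apply: ul => //.
have k0 := sz_neq0 szR szk; have l0 := sz_neq0 szR szl.
case: (szR) => _ szM El _; have [q [c [lE szc]]] := El l k k0.
have [c0|c0] := eqVneq c 0.
  by rewrite lE c0 addr0 mulrA; exists (m * q).
have szc1 : sz c = 1%N by have := sz_gt0 szR c0; lia.
have [c' [szc' cc' c'c]] := sz1_unit szR szc1.
have c'0 := sz_neq0 szR szc'.
have kQ : right_div k (Q * m * c).
  have -> : Q * m * c = Q * m * l - Q * m * q * k.
    by rewrite lE mulrDr !mulrA addrC addKr.
  by apply: right_divB => //; exists (Q * m * q).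
have szkc : sz (k * c') = 2%N by rewrite szM // szk szc'.
have [||e ke] := right_div_antisym szR (l := m) (m := k * c') _ (sz_neq0 szR szkc).
- by rewrite szkc.
- apply: um => //; case: kQ => e ke; exists e.
  by rewrite mulrA -ke -mulrA cc' mulr1.
rewrite lE mulrDr; apply: right_divD; first by exists (m * q); rewrite mulrA.
by exists e; rewrite ke -!mulrA c'c mulr1.
Qed.

(* Left divisibility is expressed as [right_div] in the opposite ring [R^c]. *)
Lemma uniq_lin_div_pair_conv (R : nzRingType) (sz : R -> nat) (a b : R) :
  euclidean_size sz -> sz a = 2%N -> sz b = 2%N ->
  @uniq_lin_div R^c sz a (a * b : R) -> @uniq_lin_div R sz b (a * b).
Proof.
move=> szR sza szb u m szm [q qE]; have m0 := sz_neq0 szR szm.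
have a0 := sz_neq0 szR sza; have b0 := sz_neq0 szR szb.
have q0 : q != 0.
  by apply: contra_neq (szM_neq0 szR a0 b0) => q0; rewrite qE q0 mul0r.
have szq : sz q = 2%N.
  case: (szR) => _ szM _ _; have := szM _ _ a0 b0; rewrite qE szM // sza szb szm.
  by have := sz_gt0 szR q0; lia.
(* The cofactor [q] of a linear right divisor is a linear left divisor, so it is [a] times some [e];
   cancelling [a] turns this into a statement about [m]. *)
have [e qa] : @right_div R^c a q by apply: u => //; exists m.
have bE : b = (e : R) * m.
  by apply: (szMI szR a0); rewrite qE [in LHS]qa /= mulrA.
by apply: (right_div_antisym szR); rewrite ?szb ?szm //; exists e.
Qed.

(** * The skew polynomial ring *)

Section SkewMul.
Variables (F : unitRingType) (sigma : {rmorphism F -> F}) (delta : F -> F).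
Hypothesis hd : is_sderivation sigma delta.
Implicit Types (p q r : {poly F}) (b c : F).

Local Notation xm := (skew_mulX sigma delta).
Local Notation sm := (skew_mul sigma delta).

Lemma sderivD b c : delta (b + c) = delta b + delta c.
Proof. by case: hd => h _; apply: h. Qed.

Lemma sderivM b c : delta (b * c) = sigma b * delta c + delta b * c.
Proof. by case: hd => _ h; apply: h. Qed.

Lemma sderiv0 : delta 0 = 0.
Proof. by apply: (addrI (delta 0)); rewrite -sderivD !addr0. Qed.

Lemma sderiv1 : delta 1 = 0.
Proof.
have := sderivM 1 1; rewrite rmorph1 !mulr1 mul1r => e.
by apply: (addrI (delta 1)); rewrite addr0 -e.
Qed.

Lemma coef_skew_mulX q i :
  (xm q)`_i = (if i is j.+1 then sigma q`_j else 0) + delta q`_i.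
Proof.
rewrite /skew_mulX coefD coefMX (coef_map_id0 _ _ sderiv0).
by case: i => [|i] //=; rewrite coef_map.
Qed.

Lemma skew_mulX0 : xm 0 = 0.
Proof. by apply/polyP => -[|i];
  rewrite coef_skew_mulX !coef0 sderiv0 ?rmorph0 addr0. Qed.

Lemma skew_mulXD : {morph xm : p q / p + q}.
Proof.
move=> p q; apply/polyP => i; rewrite coefD !coef_skew_mulX !coefD sderivD.
by case: i => [|i]; rewrite ?rmorphD /= ?coefD ?rmorphD ?add0r // addrACA.
Qed.

Lemma skew_mulXZ c q : xm (c *: q) = sigma c *: xm q + delta c *: q.
Proof.
apply/polyP => i; rewrite [RHS]coefD !coefZ !coef_skew_mulX coefZ sderivM.
by case: i => [|i]; rewrite ?coefZ ?rmorphM /= ?add0r // mulrDr addrA.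
Qed.

Lemma skew_mulX_MX q : xm (q * 'X) = xm q * 'X.
Proof.
apply/polyP => i; rewrite coefMX !coef_skew_mulX coefMX.
by case: i => [|i] /=; rewrite ?sderiv0 ?addr0 // !coefMX; case: i;
  rewrite /= ?rmorph0.
Qed.

Lemma skew_mulXC c : xm c%:P = sigma c *: 'X + (delta c)%:P.
Proof.
apply/polyP => i; rewrite coef_skew_mulX coefD coefZ coefX !coefC.
by case: i => [|[|i]]; rewrite ?coefC /= ?mulr0 ?mulr1 ?rmorph0 ?sderiv0 ?add0r.
Qed.

Lemma skew_mul_wide n p q : (size p <= n)%N ->
  sm p q = \sum_(i < n) p`_i *: iter i xm q.
Proof.
move=> szp; rewrite /skew_mul (big_ord_widen n (fun i => p`_i *: iter i xm q)) //.
rewrite big_mkcond; apply: eq_bigr => i _; case: ltnP => // pi.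
by rewrite nth_default // scale0r.
Qed.

Lemma iter_skew_mulXD n : {morph iter n xm : p q / p + q}.
Proof. by move=> p q; elim: n => //= n ->; rewrite skew_mulXD. Qed.

Lemma skew_mulDl p q r : sm (p + q) r = sm p r + sm q r.
Proof.
set n := maxn (size p) (size q).
rewrite !(@skew_mul_wide n) ?leq_maxl ?leq_maxr //; last exact: size_polyD.
by rewrite -big_split; apply: eq_bigr => i _; rewrite coefD scalerDl.
Qed.

Lemma skew_mulDr p q r : sm p (q + r) = sm p q + sm p r.
Proof.
rewrite /skew_mul -big_split; apply: eq_bigr => i _.
by rewrite iter_skew_mulXD scalerDr.
Qed.

Lemma skew_mul0l q : sm 0 q = 0.
Proof. by rewrite /skew_mul size_poly0 big_ord0. Qed.

Lemma skew_mul0r p : sm p 0 = 0.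
Proof. by apply: (addrI (sm p 0)); rewrite -skew_mulDr !addr0. Qed.

Lemma skew_mulZl c p q : sm (c *: p) q = c *: sm p q.
Proof.
rewrite (@skew_mul_wide (size p)) ?size_scale_leq // scaler_sumr.
by apply: eq_bigr => i _; rewrite coefZ scalerA.
Qed.

Lemma skew_mulCl c q : sm c%:P q = c *: q.
Proof. by rewrite (@skew_mul_wide 1) ?size_polyC_leq1 // big_ord1 coefC. Qed.

Lemma skew_mulMX p q : sm (p * 'X) q = sm p (xm q).
Proof.
rewrite (@skew_mul_wide (size p).+1) ?size_polyMX_leq //; last first.
  by apply: leq_trans (size_polyMleq _ _) _; rewrite size_polyX addn2.
rewrite big_ord_recl coefMX /= scale0r add0r; apply: eq_bigr => i _.
by rewrite coefMX /= -iterSr.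
Qed.

(** Associativity with left factor x, the case to which the general one reduces by induction on the
    left factor. *)
Lemma skew_mulX_mul q r : xm (sm q r) = sm (xm q) r.
Proof.
elim/poly_ind: q r => [|q c IH] r;
  first by rewrite skew_mulX0 skew_mul0l skew_mulX0.
rewrite skew_mulDl skew_mulMX skew_mulCl skew_mulXD IH skew_mulXZ.
rewrite skew_mulXD skew_mulX_MX skew_mulXC; move: (xm q) => q'.
rewrite !skew_mulDl skew_mulMX skew_mulZl -['X]mul1r skew_mulMX -[1]/(1%:P).
by rewrite !skew_mulCl scale1r.
Qed.

Lemma skew_mulA p q r : sm p (sm q r) = sm (sm p q) r.
Proof.
elim/poly_ind: p q => [|p c IH] q; first by rewrite !skew_mul0l.
by rewrite !skew_mulDl !skew_mulMX !skew_mulCl skew_mulX_mul IH ?skew_mulDl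
  skew_mulZl.
Qed.

Lemma skew_mulXXn n : xm 'X^n = 'X^(n.+1).
Proof.
apply/polyP => i; rewrite coef_skew_mulX !coefXn.
case: i => [|i]; rewrite ?coefXn ?eqSS.
  by case: (_ == _); rewrite /= ?sderiv1 ?sderiv0 addr0.
case: (i == n); case: (i.+1 == n).
all: by rewrite /= ?rmorph1 ?rmorph0 ?sderiv1 ?sderiv0 addr0.
Qed.

(** Powers of x on the right need no commutation, so the skew and ordinary products agree; [n = 0]
    yields the right unit law. *)
Lemma skew_mul_Xn p n : sm p 'X^n = p * 'X^n.
Proof.
elim/poly_ind: p n => [|p c IH] n; first by rewrite skew_mul0l mul0r.
by rewrite skew_mulDl skew_mulMX skew_mulXXn IH skew_mulCl mulrDl exprS mulrA
  mul_polyC.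
Qed.

Lemma skew_mul1l p : sm 1 p = p.
Proof. by rewrite -[1]/(1%:P) skew_mulCl scale1r. Qed.

Lemma skew_mul1r p : sm p 1 = p.
Proof. by have := skew_mul_Xn p 0; rewrite expr0 mulr1. Qed.

End SkewMul.

(* [{poly F}] with the skew multiplication; the derivation hypothesis is part
   of the type because the ring axioms depend on it. *)
Definition skew_poly (F : unitRingType) (sigma : {rmorphism F -> F})
  (delta : F -> F) (hd : is_sderivation sigma delta) : Type := {poly F}.

Section SkewRing.
Variables (F : unitRingType) (sigma : {rmorphism F -> F}) (delta : F -> F).
Hypothesis hd : is_sderivation sigma delta.

HB.instance Definition _ := GRing.Zmodule.copy (skew_poly hd) {poly F}.
HB.instance Definition _ := GRing.Zmodule_isNzRing.Build (skew_poly hd)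
  (skew_mulA hd) (skew_mul1l sigma delta) (skew_mul1r hd)
  (skew_mulDl sigma delta) (skew_mulDr hd) (oner_neq0 {poly F}).

Definition skew_size (p : skew_poly hd) : nat := size (p : {poly F}).

End SkewRing.

(** * Degrees and Euclidean division on both sides *)

Section DivisionRing.
Variables (F : unitRingType) (sigma : {rmorphism F -> F}) (delta : F -> F).
Hypothesis hd : is_sderivation sigma delta.
Hypothesis divF : forall x : F, x != 0 -> x \is a GRing.unit.
Hypothesis sigma_surj : forall y : F, exists x, sigma x = y.
Implicit Types (p q r : {poly F}) (a b c : F).

Local Notation xm := (skew_mulX sigma delta).
Local Notation sm := (skew_mul sigma delta).
Local Notation R := (skew_poly hd).
Local Notation P := (Pseq sigma delta).

Lemma divF_mul_neq0 a b : a != 0 -> b != 0 -> a * b != 0.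
Proof. by move=> /divF ua b0; apply: contra_neq b0 => e; apply: (mulrI ua);
  rewrite e mulr0. Qed.

Lemma sigma_neq0 a : a != 0 -> sigma a != 0.
Proof.
by move=> /divF ua; apply: contraTneq (rmorph_unit sigma ua) => ->; rewrite unitr0.
Qed.

Lemma sigma_inj : injective sigma.
Proof.
move=> a b e; apply/eqP; rewrite -subr_eq0; apply/negPn/negP => /sigma_neq0.
by rewrite rmorphB e subrr eqxx.
Qed.

Lemma iter_sigma_neq0 n a : a != 0 -> iter n sigma a != 0.
Proof. by move=> a0; elim: n => //= n; apply: sigma_neq0. Qed.

Lemma iter_sigma_surj n b : exists a, iter n sigma a = b.
Proof.
elim: n b => [|n IH] b; first by exists b.
by have [c <-] := sigma_surj b; have [a <-] := IH c; exists a.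
Qed.

Lemma size_skew_mulX q : q != 0 ->
  size (xm q) = (size q).+1 /\ lead_coef (xm q) = sigma (lead_coef q).
Proof.
move=> q0; have sq : (0 < size q)%N by rewrite size_poly_gt0.
have cq : (xm q)`_(size q) = sigma (lead_coef q).
  rewrite (coef_skew_mulX hd) (nth_default _ (leqnn _)) (sderiv0 hd) addr0.
  by rewrite lead_coefE; case: (size q) sq.
have szE : size (xm q) = (size q).+1.
  apply/anti_leq/andP; split.
    apply/leq_sizeP => -[//|j] qj; rewrite (coef_skew_mulX hd).
    by rewrite !nth_default ?rmorph0 ?(sderiv0 hd) ?addr0 // ltnW.
  rewrite ltnNge; apply/negP => /leq_sizeP/(_ _ (leqnn _)); rewrite cq.
  by apply/eqP/sigma_neq0; rewrite lead_coef_eq0.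
by split; rewrite // lead_coefE szE.
Qed.

(** Moving the leading coefficient of [q] left past x^n applies [sigma] n times; [sigma] has trivial
    kernel, so no leading term is lost. *)
Lemma size_skew_mul p q : p != 0 -> q != 0 ->
  size (sm p q) = (size p + size q).-1 /\
  lead_coef (sm p q) = lead_coef p * iter (size p).-1 sigma (lead_coef q).
Proof.
elim/poly_ind: p q => [|p c IH] q; first by rewrite eqxx.
case: (eqVneq p 0) => [->|p0] pc0 q0.
  rewrite mul0r add0r in pc0 *; rewrite polyC_eq0 in pc0.
  rewrite skew_mulCl size_polyC pc0 lead_coefC /=.
  have e : (c *: q)`_(size q).-1 = c * lead_coef q by rewrite coefZ.
  have ne : c * lead_coef q != 0 by rewrite divF_mul_neq0 ?lead_coef_eq0.
  have sz : size (c *: q) = size q.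
    apply/anti_leq; rewrite size_scale_leq /=; move: q0; rewrite -size_poly_gt0.
    case: (size q) e => // n /= e _; rewrite ltnNge; apply/negP => /leq_sizeP.
    by move/(_ _ (leqnn _)); rewrite e => /eqP; rewrite (negbTE ne).
  by split=> //; rewrite lead_coefE sz.
have [sx lx] := size_skew_mulX q0.
have [|sp lp] := IH (xm q) p0; first by rewrite -size_poly_gt0 sx.
have sp0 : (0 < size p)%N by rewrite size_poly_gt0.
have lt : (size (sm c%:P q) < size (sm p (xm q)))%N.
  by rewrite skew_mulCl sp sx (leq_ltn_trans (size_scale_leq _ _)) //; lia.
have lt' : (size c%:P < size (p * 'X)%R)%N.
  by rewrite size_mulX // (leq_ltn_trans (size_polyC_leq1 _)).
rewrite skew_mulDl skew_mulMX !size_polyDl // !lead_coefDl // sp lp sx lx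
  size_mulX //.
split; first by lia.
by rewrite lead_coefMX; congr (_ * _); case: (size p) sp0 => // n _;
  rewrite -iterSr.
Qed.

Lemma size_sub_lead p q : p != 0 -> size p = size q -> lead_coef p = lead_coef q ->
  (size (p - q)%R < size p)%N.
Proof.
rewrite -size_poly_gt0 !lead_coefE => p0 e; rewrite -e => elc.
rewrite -(prednK p0) ltnS; apply/leq_sizeP => j jp; rewrite coefB.
case: (eqVneq j (size p).-1) => [->|ne]; first by rewrite elc subrr.
have pj : (size p <= j)%N by lia.
by rewrite !nth_default ?subrr // -e.
Qed.

Lemma skew_divl p g : g != 0 -> exists q s, p = sm q g + s /\ (size s < size g)%N.
Proof.
move=> g0; have [n] := ubnP (size p); elim: n p => // n IH p szp.
have [lt|le] := ltnP (size p) (size g).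
  by exists 0, p; rewrite skew_mul0l add0r.
have sg : (0 < size g)%N by rewrite size_poly_gt0.
have p0 : p != 0 by rewrite -size_poly_gt0; lia.
(* The product of c x^k with [g] has leading coefficient c sigma^k(lead g), which dictates [c]. *)
pose k := (size p - size g)%N; pose lg := iter k sigma (lead_coef g).
have lg0 : lg != 0 by rewrite iter_sigma_neq0 ?lead_coef_eq0.
pose c := lead_coef p * lg^-1.
have lgV0 : lg^-1 != 0 by rewrite invr_eq0.
have c0 : c != 0 by rewrite divF_mul_neq0 ?lead_coef_eq0.
pose t : {poly F} := c%:P * 'X^k.
have szt : size t = k.+1 by rewrite size_mulXn ?polyC_eq0 // size_polyC c0 addn1.
have t0 : t != 0 by rewrite -size_poly_gt0 szt.
have [stg ltg] := size_skew_mul t0 g0.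
have [|q [s [e szs]]] := IH (p - sm t g).
  rewrite -ltnS; apply: leq_trans szp; rewrite ltnS; apply: size_sub_lead => //.
    by rewrite stg szt /k; lia.
  by rewrite ltg szt lead_coef_Mmonic ?monicXn // lead_coefC /= mulrVK ?divF.
exists (q + t), s; split=> //.
by rewrite skew_mulDl addrAC -e subrK.
Qed.

Lemma skew_divr p g : g != 0 -> exists q s, p = sm g q + s /\ (size s < size g)%N.
Proof.
move=> g0; have [n] := ubnP (size p); elim: n p => // n IH p szp.
have [lt|le] := ltnP (size p) (size g).
  by exists 0, p; rewrite (skew_mul0r hd) add0r.
have sg : (0 < size g)%N by rewrite size_poly_gt0.
have p0 : p != 0 by rewrite -size_poly_gt0; lia.
pose k := (size p - size g)%N.
(* On this side [c] is twisted: [g] times c x^k has leading coefficient lead(g) sigma^(deg g)(c), so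
   [c] must be a preimage, given by surjectivity. *)
have [c cE] := iter_sigma_surj (size g).-1 ((lead_coef g)^-1 * lead_coef p).
have lg0 : lead_coef g != 0 by rewrite lead_coef_eq0.
have c0 : c != 0.
  apply/eqP => c0; have : (lead_coef g)^-1 * lead_coef p != 0.
    by rewrite divF_mul_neq0 ?invr_eq0 ?lead_coef_eq0.
  by rewrite -cE c0 iter_fix ?rmorph0 ?eqxx.
pose t : {poly F} := c%:P * 'X^k.
have szt : size t = k.+1 by rewrite size_mulXn ?polyC_eq0 // size_polyC c0 addn1.
have t0 : t != 0 by rewrite -size_poly_gt0 szt.
have [stg ltg] := size_skew_mul g0 t0.
have [|q [s [e szs]]] := IH (p - sm g t).
  rewrite -ltnS; apply: leq_trans szp; rewrite ltnS; apply: size_sub_lead => //.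
    by rewrite stg szt /k; lia.
  by rewrite ltg lead_coef_Mmonic ?monicXn // lead_coefC cE mulrA mulrV ?mul1r
    ?divF.
exists (q + t), s; split=> //.
by rewrite (skew_mulDr hd) addrAC -e subrK.
Qed.

Lemma skew_size_euclidean : euclidean_size (@skew_size F sigma delta hd).
Proof.
split.
- exact: size_poly_eq0.
- by move=> u v u0 v0; case: (size_skew_mul u0 v0).
- exact: skew_divl.
- exact: skew_divr.
Qed.

End DivisionRing.

(** * Products of linear skew polynomials *)

Section Linear.
Variables (F : unitRingType) (sigma : {rmorphism F -> F}) (delta : F -> F).
Hypothesis hd : is_sderivation sigma delta.
Hypothesis divF : forall x : F, x != 0 -> x \is a GRing.unit.
Hypothesis sigma_surj : forall y : F, exists x, sigma x = y.
Hypothesis halg : forall a : F, algebraic_set sigma delta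
  (conj_class sigma delta a).

Local Notation R := (skew_poly hd).
Local Notation P := (Pseq sigma delta).
Local Notation ssz := (@skew_size F sigma delta hd).

Definition cst (c : F) : R := (c%:P : {poly F}).
Definition lin (b : F) : R := ('X - b%:P : {poly F}).

Let szR : euclidean_size ssz. Proof. exact: skew_size_euclidean. Qed.

Lemma cstM a b : cst (a * b) = cst a * cst b.
Proof.
by rewrite [RHS](skew_mulCl sigma delta a b%:P) -mul_polyC -polyCM.
Qed.

Lemma cst0 : cst 0 = 0. Proof. exact: polyC0. Qed.
Lemma cstD a b : cst (a + b) = cst a + cst b. Proof. exact: polyCD. Qed.
Lemma cstN a : cst (- a) = - cst a. Proof. exact: polyCN. Qed.
Lemma cstB a b : cst (a - b) = cst a - cst b. Proof. exact: polyCB. Qed.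
Lemma cst1 : cst 1 = 1. Proof. by []. Qed.

Lemma cstK a (p : R) : a != 0 -> p * cst a * cst a^-1 = p.
Proof. by move=> /divF ua; rewrite -mulrA -cstM divrr // cst1 mulr1. Qed.

Lemma cstKV a (p : R) : a != 0 -> p * cst a^-1 * cst a = p.
Proof. by move=> /divF ua; rewrite -mulrA -cstM mulVr // cst1 mulr1. Qed.

Lemma ssz_cst c : c != 0 -> ssz (cst c) = 1%N.
Proof. by move=> c0; rewrite /skew_size size_polyC c0. Qed.

Lemma ssz1_cst (p : R) : (ssz p <= 1)%N -> exists c, p = cst c.
Proof. by move=> /size1_polyC ->; exists (p : {poly F})`_0. Qed.

Lemma ssz_lin b : ssz (lin b) = 2%N.
Proof. exact: size_XsubC. Qed.

Lemma lin_neq0 b : lin b != 0.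
Proof. have h := sz_neq0 szR (ssz_lin b); exact h. Qed.

Lemma linD a b : lin a = lin b + cst (b - a).
Proof. by rewrite cstB addrA [lin b + _](@subrK {poly F}). Qed.

Lemma lin_cst b c : lin b * cst c = cst (sigma c) * lin 0 + cst (delta c - b * c).
Proof.
suff e : skew_mul sigma delta ('X - b%:P) c%:P =
    skew_mul sigma delta (sigma c)%:P ('X - 0%:P) + (delta c - b * c)%:P by
      exact: e.
rewrite polyC0 subr0 skew_mulDl -polyCN !skew_mulCl -['X in LHS]mul1r skew_mulMX.
rewrite skew_mul1l (skew_mulXC hd) polyCB polyCM -addrA; congr (_ + (_ + _)).
by rewrite -mul_polyC polyCN mulNr.
Qed.

Lemma cst_lin e a : cst e * lin a = cst e * lin 0 - cst (e * a).
Proof. by rewrite (linD a 0) mulrDr -cstM sub0r mulrN cstN. Qed.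

(** For non-zero [c] the hypothesis is b = a^c with the inverse cleared. *)
Lemma lin_cst_conj a b c : b * c = sigma c * a + delta c ->
  lin b * cst c = cst (sigma c) * lin a.
Proof.
by move=> e; rewrite lin_cst (cst_lin _ a) e opprD addrCA subrr addr0 cstN.
Qed.

Lemma right_div_cst a c : right_div (lin a) (cst c) -> c = 0.
Proof.
move=> h; apply/eqP/negPn/negP => c0.
have := right_div_sz szR (sz_neq0 szR (ssz_cst c0)) h.
by rewrite ssz_lin ssz_cst.
Qed.

Lemma right_div_lin_cst a b c :
  right_div (lin a) (lin b * cst c) -> b * c = sigma c * a + delta c.
Proof.
rewrite lin_cst => h; have : right_div (lin a)
  (cst (delta c - b * c + sigma c * a)).
  have -> : cst (delta c - b * c + sigma c * a) =
      cst (sigma c) * lin 0 + cst (delta c - b * c) - cst (sigma c) * lin a.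
    by rewrite (cst_lin _ a) opprB cstD [RHS]addrC addrA subrK addrC.
  by apply: right_divB => //; apply: right_divMl; apply: right_div_refl.
move/right_div_cst/eqP; rewrite addrAC subr_eq0 => /eqP <-; exact: addrC.
Qed.

Lemma right_div_lin_inj a b : right_div (lin a) (lin b) -> b = a.
Proof.
have := @right_div_lin_cst a b 1;
  rewrite cst1 !mulr1 rmorph1 mul1r (sderiv1 hd) addr0.
exact.
Qed.

Lemma size2_poly (m : {poly F}) : size m = 2%N ->
  m`_1 != 0 /\ m = m`_1 *: 'X + (m`_0)%:P.
Proof.
move=> szm; split.
  have : lead_coef m != 0 by rewrite lead_coef_eq0 -size_poly_gt0 szm.
  by rewrite lead_coefE szm.
apply/polyP => -[|[|i]]; rewrite coefD coefZ coefX coefC /= ?mulr0 ?mulr1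
  ?add0r ?addr0 //.
by rewrite nth_default // szm.
Qed.

Lemma ssz2_lin (m : R) : ssz m = 2%N ->
  exists e k, e != 0 /\ m = cst e * lin 0 + cst k.
Proof.
move=> /size2_poly[m1 mE]; exists (m : {poly F})`_1, (m : {poly F})`_0.
split=> //; rewrite [LHS]mE [cst _ * _](skew_mulCl sigma delta _ ('X - 0%:P)).
by rewrite polyC0 subr0.
Qed.

Lemma lin_factl (m : R) : ssz m = 2%N -> exists e b, e != 0 /\ m = cst e * lin b.
Proof.
move=> /ssz2_lin[e [k [e0 ->]]]; exists e, (- (e^-1 * k)); split=> //.
by rewrite (cst_lin _ (- _)) mulrN mulVKr ?divF // cstN opprK.
Qed.

Lemma lin_factr (m : R) : ssz m = 2%N -> exists b c, c != 0 /\ m = lin b * cst c.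
Proof.
move=> /ssz2_lin[e [k [e0 ->]]]; have [c ce] := sigma_surj e.
have c0 : c != 0 by apply: contra_neq e0 => c0; rewrite -ce c0 rmorph0.
(* This root makes the constant term [delta c - b * c] equal to [k]. *)
exists ((delta c - k) / c), c; split=> //.
by rewrite lin_cst ce mulrVK ?divF // opprB (addrC (delta c)) subrK.
Qed.

Lemma sconj_mul a c : c != 0 -> sconj sigma delta a c * c = sigma c * a + delta c.
Proof. by move=> c0; rewrite /sconj -mulrDl mulrVK ?divF. Qed.

(** Modulo x - a only constants [c] have to be tested. As f = g (x - a^c), moving [c] across gives f
    c = g sigma(c) (x - a). *)
Lemma skew_bounded : bounded_lin ssz.
Proof.
move=> l /lin_factl[e [a [e0 lE]]]; have [f [f0 fP]] := halg a.
exists (f : R) => [|r]; first exact: f0.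
suff [k kE] : right_div (lin a) ((f : R) * r).
  by exists (k * cst e^-1); rewrite kE lE mulrA cstKV.
case: (szR) => _ _ El _; have [q [s [-> szs]]] := El r (lin a) (lin_neq0 a).
rewrite mulrDr; apply: right_divD; first by exists ((f : R) * q); rewrite mulrA.
move: szs; rewrite ssz_lin ltnS => /ssz1_cst[c ->].
case: (eqVneq c 0) => [->|c0]; first by exists 0; rewrite cst0 mulr0 mul0r.
have [g gE] : right_div (lin (sconj sigma delta a c)) (f : R).
  by apply: fP; exists c.
rewrite gE -mulrA (lin_cst_conj (sconj_mul a c0)) mulrA.
by apply: right_divMl; apply: right_div_refl.
Qed.

Definition Pskew (s : seq F) : R := P s.

Lemma Pskew_cons a s : Pskew (a :: s) = Pskew s * lin a. Proof. by []. Qed.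

Lemma Pskew_nil : Pskew [::] = 1. Proof. by []. Qed.

Lemma Pskew_rcons s a : Pskew (rcons s a) = lin a * Pskew s.
Proof.
elim: s => [|b s IH]; first by rewrite Pskew_cons Pskew_nil mul1r mulr1.
by rewrite rcons_cons !Pskew_cons IH mulrA.
Qed.

Lemma Pskew_neq0 s : Pskew s != 0.
Proof.
elim: s => [|a s IH]; first exact: oner_neq0.
rewrite Pskew_cons; exact: (szM_neq0 szR IH (lin_neq0 a)).
Qed.

Lemma Pskew2 a b : Pskew [:: a; b] = lin b * lin a.
Proof. by rewrite !Pskew_cons Pskew_nil mul1r. Qed.

Lemma mult_seqP a s :
  mult_seq sigma delta (a :: s) <-> uniq_lin_div ssz (lin a) (Pskew (a :: s)).
Proof.
split=> [[_ u] m szm mP|u].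
  have [e [b [e0 mE]]] := lin_factl szm; have <- : b = a.
    by apply: u; have [q qE] := mP; exists (q * cst e);
      rewrite -[LHS]/(Pskew _) qE mE mulrA.
  by exists (cst e).
split=> [|b bP]; first by exists (P s).
by apply: right_div_lin_inj; apply: u; [apply: ssz_lin | exact: bP].
Qed.

Definition left_uniq a s : Prop := @uniq_lin_div R^c ssz (lin a) (Pskew s).

Lemma left_uniqP s : s != [::] ->
  left_uniq (last 0 s) s <->
  (forall f : {poly F}, size f = 2%N -> lead_coef f = 1 ->
     ldvd sigma delta f (P s) -> f = 'X - (last 0 s)%:P).
Proof.
case/lastP: s => // s a _; rewrite last_rcons;
  split=> [u f szf lf [q qE]|u m szm mP].
  have [|k kE] := u (f : R) szf; first by exists (q : R).
  have {}kE : f = skew_mul sigma delta (lin a) k by exact: kE.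
  have k0 : (k : {poly F}) != 0.
    apply/eqP => k0; move: szf; rewrite kE k0 (skew_mul0r hd) size_poly0; lia.
  have [szE lE] := size_skew_mul hd divF (lin_neq0 a : 'X - a%:P != 0) k0.
  rewrite -kE szf size_XsubC in szE.
  have [|c kc] := ssz1_cst (p := k); first by rewrite /skew_size; lia.
  rewrite -kE lf size_XsubC lead_coefXsubC mul1r kc lead_coefC /= in lE.
  (* The cofactor is a constant [c] on the right of x - a, so being monic says [sigma c = 1]. *)
  have c1 : c = 1 by apply: (sigma_inj divF); rewrite rmorph1; exact: esym lE.
  by rewrite kE kc c1; exact: (mulr1 (lin a)).
(* Left divisors absorb units on the right, so the constant is split off on that side. *)
have [b [c [c0 mE]]] := lin_factr szm; have [q qE] := mP.
have ldv : ldvd sigma delta (lin b) (P (rcons s a)).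
  exists (cst c * (q : R)); suff e : Pskew (rcons s a) = lin b *
    (cst c * (q : R)) by exact: e.
  by rewrite mulrA -mE; exact: qE.
have bE := u (lin b) (ssz_lin b) (lead_coefXsubC b) ldv.
by exists (cst c); rewrite mE; congr (_ * _).
Qed.

Lemma mult_pair a b : @uniq_lin_div R^c ssz (lin b) (lin b * lin a : R) ->
  mult_seq sigma delta [:: a; b].
Proof.
move=> /(uniq_lin_div_pair_conv szR (ssz_lin b) (ssz_lin a)) u.
by apply/mult_seqP; rewrite Pskew2.
Qed.

Lemma mult_pair_left a b : mult_seq sigma delta [:: a; b] ->
  @uniq_lin_div R^c ssz (lin b) (lin b * lin a : R).
Proof.
move=> /mult_seqP; rewrite Pskew2 => u.
exact: (uniq_lin_div_pair_conv (euclidean_size_conv szR) (ssz_lin a) (ssz_lin b) u).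
Qed.

(** * Consecutive pairs and whole sequences *)

Definition mult_pairs (s : seq F) : Prop := forall i, (i.+1 < size s)%N ->
  mult_seq sigma delta [:: nth 0 s i; nth 0 s i.+1].

Lemma mult_pairs_cons a b s :
  mult_pairs [:: a, b & s] <->
  mult_seq sigma delta [:: a; b] /\ mult_pairs (b :: s).
Proof.
split=> [h|[h1 h2] [_|i]] //; last exact: (h2 i).
by split=> [|i]; [apply: (h 0%N) | apply: (h i.+1)].
Qed.

Lemma mult_pairs_rcons a b s : mult_pairs (rcons (rcons s b) a) <->
  mult_seq sigma delta [:: b; a] /\ mult_pairs (rcons s b).
Proof.
have h1 x : mult_pairs [:: x] by case.
have := h1 a; have := h1 b; elim: s => [|c [|d s] IH] /= hb ha.
- by rewrite mult_pairs_cons; tauto.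
- by rewrite !mult_pairs_cons; tauto.
- by move: (IH hb ha); rewrite /= !(mult_pairs_cons c); tauto.
Qed.

Lemma mult_seq_tail a b s :
  mult_seq sigma delta [:: a, b & s] -> mult_seq sigma delta (b :: s).
Proof.
move/mult_seqP => u; apply/mult_seqP => m szm mP.
apply: (uniq_lin_div_tail szR skew_bounded (ssz_lin a) (Pskew_neq0 (b :: s)) u)
  => //.
  exact: ssz_lin.
by exists (Pskew s).
Qed.

(** The first entry of [t] gives a linear right divisor, so it equals [a]; cancel x - a and continue
    with the tail, again a multiplicity sequence. *)
Lemma mult_seq_uniq s : (0 < size s)%N -> mult_seq sigma delta s ->
  forall t, size t = size s -> P t = P s -> t = s.
Proof.
elim: s => // a s IH _ ms [//|b t] [szt] e.
have ba : b = a by case: ms => _; apply; exists (P t); rewrite -e.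
rewrite ba in e *; congr (_ :: _).
have {}e : P t = P s by apply:
  (szIM szR (lin_neq0 a) (e : Pskew t * lin a = Pskew s * lin a)).
case: s IH ms szt e => [|c s] IH ms szt e; first by case: t szt e.
by apply: IH => //; apply: mult_seq_tail ms.
Qed.

(** Comparing sizes and leading coefficients shows that [q] is monic of degree 1, so it can serve as
    a factor of a sequence. *)
Lemma lin_mul_factor a b c (q : R) :
  lin b * lin a = q * lin c -> exists d, q = lin d.
Proof.
move=> e; have l0 a' : ('X - a'%:P : {poly F}) != 0 := lin_neq0 a'.
have q0 : (q : {poly F}) != 0.
  apply/eqP => q0; move: (szM_neq0 szR (lin_neq0 b) (lin_neq0 a)).
  by rewrite e [q]q0 mul0r eqxx.
have [s1 l1] := size_skew_mul hd divF (l0 b) (l0 a).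
have [s2 l2] := size_skew_mul hd divF q0 (l0 c).
have {}e : skew_mul sigma delta ('X - b%:P) ('X - a%:P) =
  skew_mul sigma delta q ('X - c%:P) := e.
rewrite -e s1 !size_XsubC in s2; rewrite -e l1 !lead_coefXsubC in l2.
have fix1 n : iter n sigma 1 = 1 by rewrite iter_fix ?rmorph1.
rewrite !fix1 !mulr1 in l2; have szq : ssz q = 2%N by rewrite /skew_size; lia.
have [x [d [x0 qE]]] := lin_factl szq; exists d; rewrite qE.
suff -> : x = 1 by rewrite cst1 mul1r.
have {}qE : (q : {poly F}) = x *: ('X - d%:P).
  by rewrite -(skew_mulCl sigma delta); exact: qE.
move: l2; rewrite lead_coefE (_ : size _ = 2%N) // qE coefZ coefB coefX coefC /=.
by rewrite subr0 mulr1.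
Qed.

(** A second divisor x - c of (x - b)(x - a) yields a factorization (x - d)(x - c), which can
    replace the first two entries. *)
Lemma uniq_mult_pairs s :
  (forall t, size t = size s -> P t = P s -> t = s) -> mult_pairs s.
Proof.
elim: s => [|a [|b s] IH] u; try by case.
apply/mult_pairs_cons; split; last first.
  apply: IH => t szt e; suff [] : a :: t = [:: a, b & s] by [].
  by apply: u; rewrite /= ?szt // e.
split=> [|c [q qE]]; first by exists (P [:: b]).
have qE' : lin b * lin a = (q : R) * lin c by rewrite -Pskew2.
have [d qd] := lin_mul_factor qE'; rewrite qd in qE'.
suff [] : [:: c, d & s] = [:: a, b & s] by [].
apply: u => //; suff : Pskew [:: c, d & s] = Pskew [:: a, b & s] by [].
by rewrite !Pskew_cons -!mulrA qE'.
Qed.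

Lemma pairs_mult_seq s : (0 < size s)%N -> mult_pairs s -> mult_seq sigma delta s.
Proof.
elim: s => // a [|b s] IH _.
  move=> _; split=> [|c]; first by exists 1; rewrite /= (skew_mul1l sigma delta).
  case=> q e; apply/esym/right_div_lin_inj; exists (q : R).
  by rewrite -[lin a]mul1r; exact: e.
move=> /mult_pairs_cons[/mult_seqP u /IH h]; apply/mult_seqP.
have /mult_seqP {}h := h isT; rewrite Pskew2 in u.
exact: (uniq_lin_div_glue szR (ssz_lin a) (ssz_lin b) h u).
Qed.

(** A left divisor of the two leftmost factors divides the whole product, which settles the last
    pair; inheritance in the opposite ring then removes the leftmost factor. *)
Lemma left_uniq_pairs s a : left_uniq a (rcons s a) -> mult_pairs (rcons s a).
Proof.
elim/last_ind: s a => [a _ [] //|s b IH a u].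
have szRc := euclidean_size_conv szR; have bdc := bounded_lin_conv szR skew_bounded.
have e : Pskew (rcons (rcons s b) a) = lin a * (lin b * Pskew s) by rewrite
  !Pskew_rcons.
rewrite /left_uniq e in u; apply/mult_pairs_rcons; split.
  apply: mult_pair => m szm [q qE]; apply: u => //; exists ((q : R) * Pskew s).
  have {}qE : lin a * lin b = (m : R) * (q : R) := qE.
  suff f : lin a * (lin b * Pskew s) = (m : R) * ((q : R) * Pskew s) by exact: f.
  by rewrite !mulrA qE.
apply: IH => m szm mP; rewrite Pskew_rcons in mP.
have Q0 : lin b * Pskew s != 0 := szM_neq0 szR (lin_neq0 b) (Pskew_neq0 s).
apply: (@uniq_lin_div_tail R^c ssz szRc bdc (lin a) (lin b * Pskew s : R) m (lin b)) => //.
- exact: ssz_lin.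
- exact: ssz_lin.
- by exists (Pskew s).
Qed.

Lemma pairs_left_uniq s a : mult_pairs (rcons s a) -> left_uniq a (rcons s a).
Proof.
elim/last_ind: s a => [a _ m szm|s b IH a].
  rewrite Pskew_cons Pskew_nil mul1r => mP.
  have szRc := euclidean_size_conv szR.
  apply: (right_div_antisym szRc) => //; last exact: (lin_neq0 a).
  by rewrite ssz_lin szm.
move=> /mult_pairs_rcons[/mult_pair_left u /IH h].
rewrite /left_uniq Pskew_rcons in h; rewrite /left_uniq !Pskew_rcons.
exact: (@uniq_lin_div_glue R^c ssz (euclidean_size_conv szR) (lin a) (lin b) (Pskew s) (ssz_lin a) (ssz_lin b) h u).
Qed.

(** Similarity makes [b] a conjugate of [a]; the excluded [beta] are those for which a second linear
    divisor appears. *)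
Lemma mult_pairP a b : mult_seq sigma delta [:: a; b] <->
  exists beta : F, beta != 0 /\ b = sconj sigma delta a beta /\
    ~ (exists c : F, beta = sigma c * a + delta c - a * c).
Proof.
split=> [/mult_seqP|[t [t0 [bE nt]]]].
  rewrite Pskew2 => u; have := uniq_lin_div_similar szR skew_bounded
    (ssz_lin a) (ssz_lin b) u.
  case=> k [szk]; have [|t kE] := @ssz1_cst k; first by rewrite szk.
  have t0 : t != 0 by apply/eqP => t0; move: szk;
    rewrite kE t0 /skew_size size_poly0.
  rewrite kE => /right_div_lin_cst bt; exists t; split=> //; split.
    by apply: (mulIr (divF t0)); rewrite sconj_mul.
  case=> c tE; have c0 : c != 0.
    by apply: contra_neq t0 => c0;
      rewrite tE c0 rmorph0 mul0r (sderiv0 hd) mulr0 subr0 addr0.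
  have cV0 : c^-1 != 0 by rewrite invr_eq0.
  (* If [t] had the excluded form, (x - b)(x - a)c would lie in R(x - a), making (x - a)c^-1 a right
     divisor of the product. Uniqueness then says that [c^-1] conjugates [a] to itself, which forces
     [t = 0]. *)
  have lc : lin a * cst c = cst (sigma c) * lin a + cst t.
    by rewrite lin_cst (cst_lin _ a) -addrA -cstN -cstD tE -!addrA addKr.
  have [k' k'E] : right_div (lin a) (lin b * lin a * cst c).
    rewrite -mulrA lc mulrDr; apply: right_divD;
      first by exists (lin b * cst (sigma c)); rewrite mulrA.
    by rewrite (lin_cst_conj bt); apply: right_divMl; apply: right_div_refl.
  have /right_div_lin_cst ac : right_div (lin a) (lin a * cst c^-1).
    apply: u; last by exists k'; rewrite mulrA -k'E cstK.
    by case: (szR) => _ szM _ _;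
      rewrite szM ?lin_neq0 ?ssz_lin ?ssz_cst // (sz_neq0 szR (ssz_cst cV0)).
  have : sigma c^-1 * t = 0.
    have : delta (c^-1 * c) = 0 by rewrite mulVr ?divF // (sderiv1 hd).
    rewrite (sderivM hd) tE => e.
    have dV : delta c^-1 = a * c^-1 - sigma c^-1 * a by rewrite ac addrC addKr.
    rewrite dV mulrBl mulrVK ?divF // in e.
    rewrite mulrBr mulrDr [sigma _ * (sigma c * a)]mulrA -rmorphM mulVr ?divF
      // rmorph1 mul1r.
    by rewrite mulrA -[RHS]e [RHS]addrCA addrA.
  by apply/eqP; rewrite
    (negbTE (divF_mul_neq0 divF (sigma_neq0 sigma divF cV0) t0)).
apply/mult_seqP; rewrite Pskew2 => m szm [q qE].
have [e [c [e0 mE]]] := lin_factl szm.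
suff -> : a = c by exists (cst e).
(* For a second divisor x - c, subtracting (x - b)(x - c) from (x - b)(x - a) leaves (x - b)g with g
   = c - a, so b = c^g. *)
apply/eqP/negPn/negP => ac; apply: nt; pose g := c - a.
have g0 : g != 0 by rewrite subr_eq0 eq_sym.
have bg : b * g = sigma g * c + delta g.
  apply: right_div_lin_cst; have -> : lin b * cst g = lin b * lin a - lin b * lin c.
    by rewrite (linD a c) mulrDr addrC addKr.
  apply: right_divB; last by apply: right_divMl; apply: right_div_refl.
  by exists (q * cst e); rewrite qE mE mulrA.
have bt : b * t = sigma t * a + delta t by rewrite bE sconj_mul.
(* Since b = c^g and b = a^t, the quotient [x] conjugates [a] to [c]; hence t = g x = c x - a x has
   the excluded form. *)
exists (g^-1 * t); set x := g^-1 * t.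
have tE : t = g * x by rewrite mulVKr ?divF.
have : sigma g * (c * x) = sigma g * (sigma x * a + delta x).
  move: bt; rewrite tE mulrA bg mulrDl (sderivM hd) rmorphM /= addrA => /addIr.
  by rewrite mulrDr !mulrA.
move/(mulrI (divF (sigma_neq0 sigma divF g0))) <-.
by rewrite [LHS]tE mulrBl.
Qed.

End Linear.

Theorem mainTheorem13 (F : unitRingType)
  (divring : forall x : F, x != 0 -> x \is a GRing.unit)
  (sigma : {rmorphism F -> F}) (delta : F -> F)
  (hdelta : is_sderivation sigma delta)
  (sigma_surj : forall y : F, exists x, sigma x = y)
  (halg : forall a : F, algebraic_set sigma delta (conj_class sigma delta a))
  (a : seq F) (hr : (2 <= size a)%N) :
  [<-> mult_seq sigma delta a;
       (forall b : seq F, size b = size a ->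
          Pseq sigma delta b = Pseq sigma delta a -> b = a);
       (forall i, (i.+1 < size a)%N ->
          mult_seq sigma delta [:: nth 0 a i; nth 0 a i.+1]);
       (forall i, (i.+1 < size a)%N ->
          exists beta : F, beta != 0 /\
            nth 0 a i.+1 = sconj sigma delta (nth 0 a i) beta /\
            ~ (exists b : F, beta = sigma b * nth 0 a i + delta b - nth 0 a i * b));
       (forall f : {poly F}, size f = 2%N -> lead_coef f = 1 ->
          ldvd sigma delta f (Pseq sigma delta a) -> f = 'X - (last 0 a)%:P)].
Proof.
have pairs4 : (forall i, (i.+1 < size a)%N ->
    exists beta : F, beta != 0 /\
      nth 0 a i.+1 = sconj sigma delta (nth 0 a i) beta /\
      ~ (exists b : F, beta = sigma b * nth 0 a i + delta b - nth 0 a i * b)) <->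
    mult_pairs sigma delta a.
  by split=> h i ia; apply/(mult_pairP hdelta divring sigma_surj halg); apply: h.
have a0 : a != [::] by case: a hr {pairs4}.
have leftP := left_uniqP hdelta divring sigma_surj a0.
have lastE : exists s b, a = rcons s b.
  by case/lastP: a a0 {hr pairs4 leftP} => // s b _; exists s, b.
tfae.
- exact: mult_seq_uniq (ltnW hr).
- exact: (uniq_mult_pairs hdelta divring sigma_surj).
- by move/pairs4.
(* Both implications involving (5) pass through consecutive pairs: this one glues them in the
   opposite ring, the last one extracts them there and glues on the right. *)
- move=> /pairs4 h; apply/leftP; case: lastE => s [b ab].
  move: h; rewrite ab last_rcons; exact: pairs_left_uniq.
- move=> /leftP h; apply: (pairs_mult_seq hdelta) => //; first exact: ltnW.
  case: lastE => s [b ab]; move: h; rewrite ab last_rcons.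
  exact: left_uniq_pairs.
Qed.
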